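(* Let $X$ be a reflexive real Banach space and $A:X\rightrightarrows X^*$ a maximal monotone operator such that $\operatorname{int}(D(A))\neq\emptyset$. Let $D$ be a dense subset of $D(A)$ and let $\tilde A$ be a selection of $A$. Then for every $x\in D(A)$ and $v\in X\setminus\{0\}$, $$\sigma_{Ax}(v)=\begin{cases}\langle\xi,v\rangle&\text{if } v\in\operatorname{int}\big(T(x;\overline{D(A)})\big),\\[1mm]\displaystyle\liminf_{\substack{w\to v,\ t\downarrow0\\ x+tw\in D}}\langle\tilde A(x+tw),w\rangle&\text{if } v\in\operatorname{bd}\big(T(x;\overline{D(A)})\big),\\[1mm]+\infty&\text{otherwise,}\end{cases}$$ where $\xi$ is any vector in the set $w\text{-}\operatorname{Limsup}_{w\to v,\,t\downarrow0,\,x+tw\in D}\tilde A(x+tw)$.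
   Context: $X^*$ is the continuous dual of $X$, $\langle\cdot,\cdot\rangle$ the duality pairing, $\to$ norm convergence and $\rightharpoonup$ weak convergence; interior, boundary, closure and density refer to the norm topology. For a set-valued operator $A:X\rightrightarrows X^*$, $D(A)=\{x\in X: Ax\neq\emptyset\}$. $A$ is monotone if $\langle x^*-y^*,x-y\rangle\ge 0$ whenever $x^*\in Ax$, $y^*\in Ay$, and maximal monotone if in addition its graph is not properly contained in the graph of another monotone operator. For such $A$ the set $\overline{D(A)}$ is convex. A selection of $A$ is a single-valued map $\tilde A:D(A)\to X^*$ with $\tilde A(y)\in Ay$ for all $y\in D(A)$. ''$D$ is a dense subset of $D(A)$'' means $D\subset D(A)\subset\overline{D}$. Support function: $\sigma_{Ax}(v)=\sup\{\langle x^*,v\rangle:x^*\in Ax\}\in\mathbb{R}\cup\{+\infty\}$. Tangent cone: for a nonempty closed convex $S\subset X$ and $x\in S$, $T(x;S)=\overline{\bigcup_{t>0}t^{-1}(S-x)}$. $w\text{-}\operatorname{Limsup}_{w\to v,\,t\downarrow0,\,x+tw\in D}\tilde A(x+tw)$ is the set of all $x^*\in X^*$ for which there exist sequences $w_n\to v$ in $X$ and $t_n\downarrow0$ (with $t_n>0$) such that $x+t_nw_n\in D$ for all $n\in\mathbb{N}$ and $\tilde A(x+t_nw_n)\rightharpoonup x^*$. The $\liminf$ is $\sup_{\varepsilon>0}\inf\{\langle\tilde A(x+tw),w\rangle:\|w-v\|<\varepsilon,\ 0<t<\varepsilon,\ x+tw\in D\}$, with values in $\mathbb{R}\cup\{+\infty\}$.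 *)

(* Defs.v *)
From HB Require Import structures.
From mathcomp Require Import all_boot all_order all_algebra.
From mathcomp Require Import all_classical all_reals all_analysis.
Set Implicit Arguments.
Unset Strict Implicit.
Unset Printing Implicit Defensive.
Import Order.TTheory GRing.Theory Num.Theory.
Import numFieldNormedType.Exports.
Local Open Scope classical_set_scope.
Local Open Scope ring_scope.

Definition clinear (R : realType) (V : normedModType R) : {pred V -> R^o} :=
  mem [set f : V -> R^o | linear f /\ continuous f].

Record dual (R : realType) (V : normedModType R) := Dual {
  dual_fun :> V -> R^o;
  dual_funP : dual_fun \in @clinear R V }.

Section dual_lmodule.
Context {R : realType} {V : normedModType R}.

HB.instance Definition _ := [isSub for @dual_fun R V].
HB.instance Definition _ := [Choice of dual V by <:].

Lemma clinear_submod_closed : submod_closed (@clinear R V).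
Proof.
split=> [|a f g]; rewrite !inE /=.
  by split; [move=> a u v; rewrite /= scaler0 addr0|exact: cst_continuous].
move=> [lf cf] [lg cg]; split.
  move=> b u v; rewrite !fctE /= lf lg !scalerDr addrACA.
  by rewrite !scalerA (mulrC a).
by move=> x; apply: cvgD; [apply: cvgZl_tmp; exact: cf|exact: cg].
Qed.

HB.instance Definition _ :=
  GRing.isSubmodClosed.Build _ _ (@clinear R V) clinear_submod_closed.
HB.instance Definition _ := [SubChoice_isSubLmodule of dual V by <:].

Lemma dual_linear (f : dual V) : linear f.
Proof. by case: f => f /=; rewrite inE /= => -[]. Qed.

HB.instance Definition _ (f : dual V) :=
  GRing.isLinear.Build R V R^o *:%R (dual_fun f) (dual_linear f).

Lemma dual_continuous (f : dual V) : continuous f.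
Proof. by case: f => f /=; rewrite inE /= => -[]. Qed.

Lemma dualP (f g : dual V) : f =1 g -> f = g.
Proof. by move=> fg; exact/val_inj/funext. Qed.

Lemma dualDE (f g : dual V) x : (f + g) x = f x + g x. Proof. by []. Qed.
Lemma dualBE (f g : dual V) x : (f - g) x = f x - g x. Proof. by []. Qed.
Lemma dualZE a (f : dual V) x : (a *: f) x = a * f x. Proof. by []. Qed.

Definition opnorm (f : dual V) : R :=
  sup [set `|f x| | x in [set x : V | `|x| <= 1]].

Lemma opnorm_has_sup (f : dual V) :
  has_sup [set `|f x| | x in [set x : V | `|x| <= 1]].
Proof.
split; first by exists `|f 0|, 0 => //=; rewrite normr0.
have /linear_bounded_continuous/linear_boundedP := @dual_continuous f.
move=> /pinfty_ex_gt0[M M0 fM]; exists M => _ [x /= x1 <-].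
by rewrite (le_trans (fM x))// ler_piMr// ltW.
Qed.

Lemma opnorm_ge (f : dual V) x : `|x| <= 1 -> `|f x| <= opnorm f.
Proof.
by move=> x1; apply: ub_le_sup; [case: (opnorm_has_sup f)|exists x].
Qed.

Lemma opnorm_ge0 (f : dual V) : 0 <= opnorm f.
Proof. by rewrite (le_trans (normr_ge0 (f 0)))// opnorm_ge// normr0. Qed.

Lemma opnorm_le (f : dual V) c :
  (forall x, `|x| <= 1 -> `|f x| <= c) -> opnorm f <= c.
Proof.
move=> fc; apply: ge_sup; first by case: (opnorm_has_sup f).
by move=> _ [x /= x1 <-]; exact: fc.
Qed.

Lemma opnormP (f : dual V) x : `|f x| <= opnorm f * `|x|.
Proof.
have [->|x0] := eqVneq x 0; first by rewrite linear0 !normr0 mulr0.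
have nx : 0 < `|x| by rewrite normr_gt0.
rewrite -ler_pdivrMr//; have := @opnorm_ge f (`|x|^-1 *: x).
rewrite normrZ ger0_norm ?invr_ge0// mulVf ?gt_eqF// => /(_ (lexx _)).
by rewrite linearZ /= normrZ ger0_norm ?invr_ge0// mulrC.
Qed.

Lemma opnormD (f g : dual V) : opnorm (f + g) <= opnorm f + opnorm g.
Proof.
apply: opnorm_le => x x1; rewrite dualDE (le_trans (ler_normD _ _))//.
by rewrite lerD// opnorm_ge.
Qed.

Lemma opnormZ_le a (f : dual V) : opnorm (a *: f) <= `|a| * opnorm f.
Proof.
apply: opnorm_le => x x1; rewrite dualZE normrM ler_wpM2l//.
exact: opnorm_ge.
Qed.

Lemma opnormZ a (f : dual V) : opnorm (a *: f) = `|a| * opnorm f.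
Proof.
apply/eqP; rewrite eq_le opnormZ_le /=.
have [->|a0] := eqVneq a 0; first by rewrite normr0 mul0r opnorm_ge0.
rewrite -ler_pdivlMl ?normr_gt0// -normfV.
by rewrite (le_trans _ (opnormZ_le _ _))// scalerA mulVf// scale1r.
Qed.

Lemma opnorm_eq0 (f : dual V) : opnorm f = 0 -> f = 0.
Proof.
move=> f0; apply: dualP => x; apply/eqP; rewrite -normr_le0.
by rewrite (le_trans (opnormP f x))// f0 mul0r.
Qed.

HB.instance Definition _ :=
  Lmodule_isNormed.Build R (dual V) opnormD opnormZ opnorm_eq0.

End dual_lmodule.

(* The canonical embedding of V into its bidual is onto. *)
Definition reflexive_space (R : realType) (V : normedModType R) :=
  forall phi : dual (dual V), exists x : V, forall f : dual V, phi f = f x.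

Definition weak_cvg (R : realType) (V : normedModType R)
    (u : nat -> V) (l : V) :=
  forall f : dual V, f (u n) @[n --> \oo] --> f l.

Section operators.
Context {R : realType} {X : normedModType R}.
Implicit Types (A : X -> set (dual X)) (S D : set X) (x v : X).

Definition op_dom A : set X := [set x | A x !=set0].

Definition op_graph A : set (X * dual X) := [set p | A p.1 p.2].

Definition monotone_op A :=
  forall x y (xs ys : dual X), A x xs -> A y ys -> 0 <= (xs - ys) (x - y).

Definition maximal_monotone_op A :=
  monotone_op A /\ forall B, monotone_op B -> ~ (op_graph A `<` op_graph B).

(* [At] is total for convenience; its values off [op_dom A] are arbitrary. *)
Definition is_selection A (At : X -> dual X) := forall y, op_dom A y -> A y (At y).

Definition support_fun A x v : \bar R := ereal_sup [set (xs v)%:E | xs in A x].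

Definition tangent_cone x S : set X :=
  closure (\bigcup_(t in [set t : R | 0 < t]) [set t^-1 *: (s - x) | s in S]).

Definition boundary S : set X := closure S `\` interior S.

Definition w_Limsup (At : X -> dual X) D x v : set (dual X) :=
  [set xs | exists (w : nat -> X) (t : nat -> R),
    [/\ w n @[n --> \oo] --> v,
        (forall n, 0 < t n) /\ t n @[n --> \oo] --> 0,
        forall n, D (x + t n *: w n) &
        weak_cvg (fun n => At (x + t n *: w n)) xs]].

(* [p.1] is the step t and [p.2] the direction w; the infimum of the empty set
   is +oo. *)
Definition dir_liminf (At : X -> dual X) D x v : \bar R :=
  ereal_sup [set ereal_inf
      [set (At (x + p.1 *: p.2) p.2)%:E | p in
        [set p : R * X | [/\ `|p.2 - v| < e, 0 < p.1 < e &
                             D (x + p.1 *: p.2)]]]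
    | e in [set e : R | 0 < e]].

End operators.

(* Main.v *)
(* For x in the domain of A and a step x + t w inside it, monotonicity gives
   <A~(x + t w), w> >= <x*, w> for all x* in Ax, so weak limits and lower limits
   dominate the support function.  For the converse one pushes directions towards
   a ball B(x0, r) inside the domain on which A is bounded (Baire): if
   v - eta (x0 - x) is tangent, then A is bounded on x + t w for small t and w near
   v, so bounded sequences of selected values have weakly convergent subsequences
   (reflexivity), whose limits lie in Ax by maximality and attain the support
   function at v.  A boundary direction v is approached by v + eta (x0 - x), at
   which the support function exceeds its value at v by O(eta).  A direction
   outside the tangent cone is separated from it by a normal functional f, and
   Ax + [0, +oo) f is contained in Ax.

   Convexity of the closure of the domain, as well as the needed interior points
   of the domain, come from the Mazur-Orlicz form of the Hahn-Banach theorem: z is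
   in the domain as soon as, for some M and all finite families of weights
   mu_i >= 0 and points (u_i, f_i) of the graph,
   sum mu_i <f_i, z - u_i> <= M |sum mu_i (z - u_i)|. *)
From HB Require Import structures.
Require Import Defs.
From mathcomp Require Import all_boot all_order all_algebra.
From mathcomp Require Import all_classical all_reals all_analysis.
From mathcomp Require Import ring lra.
Set Implicit Arguments.
Unset Strict Implicit.
Unset Printing Implicit Defensive.
Import Order.TTheory GRing.Theory Num.Theory.
Import numFieldNormedType.Exports.
Local Open Scope classical_set_scope.
Local Open Scope ring_scope.

(** * The Hahn-Banach theorem *)

Section hahn_banach.
Context {R : realType} {V : lmodType R}.
Implicit Types (p q : V -> R) (K : set (V * R)) (x y k : V) (b t : R).

Definition sublinear p :=
  (forall x y, p (x + y) <= p x + p y) /\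
  (forall t x, 0 <= t -> p (t *: x) <= t * p x).

(** A pair [(k, b)] encodes the constraint [b <= h k] on a linear functional [h] to be found. *)
Definition convex_cone K :=
  [/\ K (0, 0),
      forall k1 k2 b1 b2, K (k1, b1) -> K (k2, b2) -> K (k1 + k2, b1 + b2) &
      forall t k b, 0 <= t -> K (k, b) -> K (t *: k, t * b)].

Lemma sublinear0 p : sublinear p -> p 0 = 0.
Proof.
move=> [pD pZ]; have := pD 0 0; have := pZ 0 0 (lexx _).
by rewrite scale0r mul0r addr0; lra.
Qed.

Lemma sublinearN p x : sublinear p -> - p (- x) <= p x.
Proof.
move=> sp; have := sublinear0 sp; rewrite -(subrr x).
by have := sp.1 x (- x); lra.
Qed.

(* The functional is the infimal convolution [q x = inf (p (x + k) - b)] over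
   the cone. *)
Lemma sublinear_cone_inf p K : sublinear p -> convex_cone K ->
  (forall k b, K (k, b) -> b <= p k) ->
  exists q, [/\ sublinear q, forall x, q x <= p x &
                forall k b, K (k, b) -> q (- k) <= - b].
Proof.
move=> sp [K0 KD KZ] Kp.
pose E x := [set p (x + kb.1) - kb.2 | kb in K].
have E0 x : E x !=set0 by exists (p (x + 0) - 0), (0, 0).
have lE x : has_lbound (E x).
  exists (- p (- x)) => _ [[k b] /= Kkb <-].
  have := sp.1 (x + k) (- x); rewrite addrAC subrr add0r.
  by have := Kp _ _ Kkb; lra.
have qE x k b : K (k, b) -> inf (E x) <= p (x + k) - b.
  by move=> Kkb; apply: ge_inf => //; exists (k, b).
exists (fun x => inf (E x)); split.
- split=> [x y|t x].
    rewrite -lerBlDr; apply: lb_le_inf => // _ [[k b] /= Kkb <-].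
    rewrite lerBlDr -lerBlDl; apply: lb_le_inf => // _ [[k' b'] /= Kkb' <-].
    rewrite lerBlDl; apply: le_trans (qE _ _ _ (KD _ _ _ _ Kkb Kkb')) _.
    by have := sp.1 (x + k) (y + k'); rewrite addrACA; lra.
  rewrite le_eqVlt => /orP[/eqP <-|t0].
    rewrite scale0r mul0r; have := qE 0 _ _ K0.
    by rewrite addr0 sublinear0// subr0.
  rewrite -ler_pdivrMl//; apply: lb_le_inf => // _ [[k b] /= Kkb <-].
  rewrite ler_pdivrMl//; apply: le_trans (qE _ _ _ (KZ _ _ _ (ltW t0) Kkb)) _.
  by rewrite mulrBr lerD2r -scalerDr sp.2// ltW.
- by move=> x; have := qE x _ _ K0; rewrite addr0 subr0.
- by move=> k b /(qE (- k)); rewrite addNr sublinear0// sub0r.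
Qed.

(** The infimal convolution with the ray through [(y, p y)] is a sublinear minorant [q] with
    [q (- y) <= - p y]. Minimality carries this over to [p], which is thus odd, and an odd
    subadditive function is additive. *)
Lemma minimal_sublinear_linear p : sublinear p ->
  (forall q, sublinear q -> (forall x, q x <= p x) -> forall x, p x <= q x) ->
  linear (p : V -> R^o).
Proof.
move=> sp minp.
have pN y : p (- y) = - p y.
  pose K := [set (t *: y, t * p y) | t in [set t : R | 0 <= t]].
  have cK : convex_cone K.
    split; first by exists 0 => //=; rewrite scale0r mul0r.
      move=> _ _ _ _ [s /= s0 [<- <-]] [t /= t0 [<- <-]].
      by exists (s + t); [rewrite /= addr_ge0|rewrite scalerDl mulrDl].
    move=> t _ _ t0 [s /= s0 [<- <-]].
    by exists (t * s); [rewrite /= mulr_ge0|rewrite scalerA mulrA].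
  have Kp k b : K (k, b) -> b <= p k.
    move=> [t /= t0 [<- <-]]; have [->|tn0] := eqVneq t 0.
      by rewrite mul0r scale0r sublinear0.
    have {}t0 : 0 < t by rewrite lt_neqAle eq_sym tn0.
    rewrite -ler_pdivlMl//; have := sp.2 t^-1 (t *: y).
    by rewrite scalerA mulVf// scale1r => -> //; rewrite invr_ge0 ltW.
  have [q [sq qp qK]] := sublinear_cone_inf sp cK Kp.
  have := minp _ sq qp (- y); have : K (y, p y).
    by exists 1 => //=; rewrite scale1r mul1r.
  by move=> /qK; have := sublinearN y sp; lra.
have pD x y : p (x + y) = p x + p y.
  have := sp.1 x y; have := sp.1 (- x) (- y).
  by rewrite -opprD !pN; lra.
have pZ0 t x : 0 <= t -> p (t *: x) = t * p x.
  by move=> t0; have := sp.2 t x t0; have := sp.2 t (- x) t0; rewrite scalerN !pN; lra.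
move=> a x y; rewrite pD; congr (_ + _).
have [a0|a0] := leP 0 a; first exact: pZ0.
rewrite -[a]opprK scaleNr pN pZ0 ?oppr_ge0 ?ltW//.
by rewrite scaleNr.
Qed.

Theorem hahn_banach_sublinear p : sublinear p ->
  exists h : {linear V -> R^o}, forall x, h x <= p x.
Proof.
move=> sp; pose T := {q | sublinear q /\ forall x, q x <= p x}.
(* The order is reversed, so that a maximal element in Zorn's lemma is a minimal sublinear minorant
   of [p]. *)
pose Rel (q1 q2 : T) := `[< forall x, sval q2 x <= sval q1 x >].
have p0 : T by exists p.
have [|r s t|A Atot|[q [sq qp]] qmax] := @ZL_preorder T p0 Rel.
- by move=> t; apply/asboolP.
- move=> /asboolP rs /asboolP st; apply/asboolP => x.
  exact: le_trans (st x) (rs x).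
- have [[q0 Aq0]|A0] := pselect (A !=set0); last first.
    by exists p0 => s As; case: A0; exists s.
  pose E x := [set sval (q : T) x | q in A].
  have E0 x : E x !=set0 by exists (sval q0 x), q0.
  have lE x : has_lbound (E x).
    exists (- p (- x)) => _ [[q [sq qp]] /= _ <-].
    by rewrite (le_trans _ (sublinearN _ sq))// lerN2.
  have qE x (q : T) : A q -> inf (E x) <= sval q x.
    by move=> Aq; apply: ge_inf => //; exists q.
  have sE : sublinear (fun x => inf (E x)).
    split=> [x y|t x t0].
      rewrite -lerBlDr; apply: lb_le_inf => // _ [q Aq <-].
      rewrite lerBlDr -lerBlDl; apply: lb_le_inf => // _ [q' Aq' <-].
      (* Of two comparable members of the chain, the smaller one serves both [x] and [y]. *)
      rewrite lerBlDl; have [/asboolP qq'|/asboolP qq'] := Atot _ _ Aq Aq'.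
        apply: le_trans (qE _ _ Aq') _; apply: le_trans ((svalP q').1.1 _ _) _.
        by rewrite lerD2r.
      apply: le_trans (qE _ _ Aq) _; apply: le_trans ((svalP q).1.1 _ _) _.
      by rewrite lerD2l.
    move: t0; rewrite le_eqVlt => /orP[/eqP <-|t0].
      rewrite scale0r mul0r; apply: le_trans (qE _ _ Aq0) _.
      by rewrite (sublinear0 (svalP q0).1).
    rewrite -ler_pdivrMl//; apply: lb_le_inf => // _ [q Aq <-].
    rewrite ler_pdivrMl//; apply: le_trans (qE _ _ Aq) _.
    by rewrite (svalP q).1.2// ltW.
  have Ep x : inf (E x) <= p x.
    exact: le_trans (qE _ _ Aq0) ((svalP q0).2 x).
  exists (exist _ (fun x => inf (E x)) (conj sE Ep)) => s As.
  by apply/asboolP => x /=; exact: qE.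
- have lq : linear (q : V -> R^o).
    apply: minimal_sublinear_linear => // r sr rq.
    have rp x : r x <= p x by exact: le_trans (rq x) (qp x).
    by have /(_ _)/asboolP := qmax (exist _ r (conj sr rp)); apply; apply/asboolP.
  pose h := HB.pack_for {linear V -> R^o} (q : V -> R^o)
    (GRing.isLinear.Build R V R^o *:%R (q : V -> R^o) lq).
  by exists h.
Qed.

(** A linear minorant [h] of the infimal convolution has [h (- k) <= - b], which is the constraint
    [b <= h k]. *)
Theorem mazur_orlicz p K : sublinear p -> convex_cone K ->
  (forall k b, K (k, b) -> b <= p k) ->
  exists2 h : {linear V -> R^o}, (forall x, h x <= p x) &
    forall k b, K (k, b) -> b <= h k.
Proof.
move=> sp cK Kp; have [q [sq qp qK]] := sublinear_cone_inf sp cK Kp.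
have [h hq] := hahn_banach_sublinear sq; exists h => [x|k b Kkb].
  exact: le_trans (hq x) (qp x).
by have := qK _ _ Kkb; have := hq (- k); rewrite linearN /=; lra.
Qed.

End hahn_banach.

(** * Continuous functionals obtained from norm bounds *)

Section dual_functionals.
Context {R : realType} {V : normedModType R}.

Lemma dual_of_bounded (h : {linear V -> R^o}) (M : R) :
  (forall x, h x <= M * `|x|) -> exists f : dual V, f =1 h.
Proof.
move=> hM; have ch : continuous h.
  apply: bounded_linear_continuous; apply/linear_boundedP; near=> r => x.
  have Mr : M <= r by near: r; apply: nbhs_pinfty_ge; exact: num_real.
  rewrite ler_norml lerNl -linearN -{1}(normrN x).
  by rewrite !(le_trans (hM _))// ler_wpM2r.
have P : (h : V -> R^o) \in @clinear R V.
  by rewrite inE; split => //; exact: linearP.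
by exists (Dual P).
Unshelve. all: by end_near. Qed.

Lemma sublinear_norm (M : R) : 0 <= M -> sublinear (fun x : V => M * `|x|).
Proof.
move=> M0; split=> [x y|t x t0]; first by rewrite -mulrDr ler_wpM2l// ler_normD.
by rewrite normrZ ger0_norm// mulrCA.
Qed.

Lemma mazur_orlicz_dual (M : R) (K : set (V * R)) : 0 <= M -> convex_cone K ->
  (forall k b, K (k, b) -> b <= M * `|k|) ->
  exists f : dual V, forall k b, K (k, b) -> b <= f k.
Proof.
move=> M0 cK KM; have [h hM hK] := mazur_orlicz (sublinear_norm M0) cK KM.
have [f fh] := dual_of_bounded hM; exists f => k b /hK; by rewrite fh.
Qed.

End dual_functionals.

(** * Weak sequential compactness in reflexive spaces *)

Section normed_preliminaries.
Context {R : realType}.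

Lemma closure_normP (V : normedModType R) (S : set V) (x : V) :
  closure S x <-> forall e : R, 0 < e -> exists2 y, S y & `|y - x| < e.
Proof.
split=> [cx e e0|cx B /nbhs_ballP[e /= e0 eB]].
  have [y [Sy]] := cx _ (nbhsx_ballx x e e0).
  by rewrite -ball_normE /= distrC; exists y.
have [y Sy ye] := cx e e0; exists y; split => //; apply: eB.
by rewrite -ball_normE /= distrC.
Qed.

(** The norm is a supremum that may not be attained; the factor 2 leaves room for a
    near-maximiser. *)
Lemma dual_norming (V : normedModType R) (f : dual V) :
  exists2 x : V, `|x| <= 1 & `|f| <= 2 * f x.
Proof.
have [f0|f0] := eqVneq `|f| 0.
  by exists 0; rewrite ?normr0// f0 linear0 mulr0.
have fgt0 : 0 < `|f| by rewrite lt_neqAle eq_sym f0 normr_ge0.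
have [_ [x x1 <-]] := sup_adherent (divr_gt0 fgt0 (@ltr0n R 2)) (opnorm_has_sup f).
rewrite -[sup _]/(`|f|) => fx; have {}fx : `|f| <= 2 * `|f x| by lra.
have [fx0|fx0] := leP 0 (f x); first by exists x => //; rewrite -[f x]ger0_norm.
by exists (- x); rewrite ?normrN// linearN /= -[- f x]ltr0_norm.
Qed.

(** Compactness of [[- M, M]] gives a cluster point, and a cluster point of an ultrafilter is a
    limit. *)
Lemma ultrafilter_bounded_cvg (T : Type) (U : set_system T) (u : T -> R) (M : R) :
  UltraFilter U -> (forall n, `|u n| <= M) -> exists l : R, u n @[n --> U] --> l.
Proof.
move=> UU uM; have UP : ProperFilter U := @ultra_proper _ _ UU.
have uc : (u n @[n --> U]) `[- M, M]%classic.
  by apply: nearW => n /=; rewrite in_itv /= -ler_norml.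
have [l [_ lc]] := segment_compact (fmap_proper_filter _ _) uc.
exists l; apply/cvgrPdist_lt => e e0.
have [//|nU] := in_ultra_setVsetC [set n | `|l - u n| < e] UU.
have [y [/= ny ey]] :=
  lc (~` [set y | `|l - y| < e]) (ball l e) nU (nbhsx_ballx _ _ e0).
by case: ny; rewrite -ball_normE in ey.
Qed.

End normed_preliminaries.

(** * Finite linear combinations and separation from their span *)

Section lincomb.
Context {R : realType} {I : Type} {V : lmodType R}.
Implicit Types (F : I -> V) (s : seq (R * I)).

Definition lincomb F s : V := \sum_(p <- s) p.1 *: F p.2.

(** Lists may repeat an index, so adding combinations is mere concatenation. *)
Lemma lincomb_cat F s1 s2 : lincomb F (s1 ++ s2) = lincomb F s1 + lincomb F s2.
Proof. by rewrite /lincomb big_cat. Qed.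

Lemma lincombZ F a s :
  lincomb F [seq (a * p.1, p.2) | p <- s] = a *: lincomb F s.
Proof.
rewrite /lincomb big_map scaler_sumr; apply: eq_bigr => p _ /=.
by rewrite scalerA.
Qed.

Lemma lincomb1 F a i : lincomb F [:: (a, i)] = a *: F i.
Proof. by rewrite /lincomb big_seq1. Qed.

(** Mazur-Orlicz applied to the cone of pairs [(t *: x - y, e * t)] with [0 <= t] and [y] in the
    span of [F]; taking [t = 0] with both signs of [y] forces [h] to vanish on the span. *)
Lemma separate_lincomb (p : V -> R) F x (e : R) : sublinear p -> 0 <= e ->
  (forall s, e <= p (x - lincomb F s)) ->
  exists h : {linear V -> R^o},
    [/\ forall y, h y <= p y, e <= h x & forall i, h (F i) = 0].
Proof.
move=> sp e0 pe.
have p0 s : 0 <= p (lincomb F s).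
  rewrite leNgt; apply/negP => p0.
  (* If [p] were negative at a point of the span, a multiple this large would push [p] below [e] on
     [x] plus the span. *)
  pose t := `|p x| / - p (lincomb F s) + e / - p (lincomb F s) + 1.
  have t0 : 0 < t.
    by rewrite ltr_wpDl// addr_ge0// divr_ge0// oppr_ge0 ltW.
  have := pe [seq (- t * r.1, r.2) | r <- s].
  rewrite lincombZ scaleNr opprK => /le_trans/(_ (sp.1 _ _)).
  have := sp.2 t (lincomb F s) (ltW t0).
  have -> : t * p (lincomb F s) = - `|p x| - e + p (lincomb F s).
    by rewrite /t; field; rewrite lt_eqF.
  by have := ler_norm (p x); lra.
pose K : set (V * R) := [set q | exists (t : R) s, [/\ 0 <= t,
  q.1 = t *: x - lincomb F s & q.2 = e * t]].
have cK : convex_cone K.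
  split.
  - by exists 0, [::]; rewrite /lincomb big_nil scale0r subr0 mulr0.
  - move=> k1 k2 b1 b2 [t1 [s1 /= [t10 -> ->]]] [t2 [s2 /= [t20 -> ->]]].
    exists (t1 + t2), (s1 ++ s2); split; rewrite /= ?addr_ge0 ?mulrDr//.
    by rewrite lincomb_cat scalerDl opprD addrACA.
  - move=> a k b a0 [t [s /= [t0 -> ->]]].
    exists (a * t), [seq (a * r.1, r.2) | r <- s]; split; rewrite /= ?mulr_ge0//.
      by rewrite lincombZ scalerBr scalerA.
    by rewrite mulrCA.
have Kp k b : K (k, b) -> b <= p k.
  move=> [t [s /= [t0 -> ->]]]; move: t0; rewrite le_eqVlt => /orP[/eqP<-|t0].
    rewrite mulr0 scale0r sub0r -scaleN1r -lincombZ.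
    exact: p0.
  rewrite mulrC -ler_pdivlMl//.
  have := pe [seq (t^-1 * r.1, r.2) | r <- s]; rewrite lincombZ.
  move=> /le_trans; apply; have := sp.2 t^-1 (t *: x - lincomb F s).
  rewrite invr_ge0 (ltW t0) scalerBr scalerA mulVf ?gt_eqF// scale1r.
  exact.
have [h hp hK] := mazur_orlicz sp cK Kp; exists h; split => // [|i].
  apply: hK; exists 1, [::].
  by rewrite /lincomb big_nil scale1r subr0 mulr1 ler01.
have hi a : 0 <= a * h (F i).
  have := hK (a *: F i) 0; rewrite linearZ /=; apply.
  exists 0, [:: (- a, i)]; split; rewrite //= ?mulr0//.
  by rewrite lincomb1 scale0r sub0r scaleNr opprK.
by have := hi 1; have := hi (-1); rewrite mul1r mulN1r; lra.
Qed.

End lincomb.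

Section reflexive_sequential_compactness.
Context {R : realType}.

Lemma lincomb_rat_approx (V : normedModType R) (F : nat -> V) s (e : R) : 0 < e ->
  exists r : seq (rat * nat),
    `|lincomb F [seq (ratr p.1, p.2) | p <- r] - lincomb F s| < e.
Proof.
elim: s e => [|[a i] s IH] e e0.
  by exists [::]; rewrite /lincomb !big_nil subrr normr0.
have e20 : 0 < e / 2 by rewrite divr_gt0.
have [r rs] := IH _ e20.
have F0 : 0 < 1 + `|F i| by rewrite ltr_wpDr.
pose d := e / 2 / (1 + `|F i|).
have d0 : 0 < d by rewrite divr_gt0.
have [c] := @rat_in_itvoo R (a - d) (a + d) (ltac:(lra)).
rewrite in_itv /= => /andP[ac ca]; exists ((c, i) :: r).
rewrite /lincomb /= !big_cons opprD addrACA -scalerBl.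
rewrite (le_lt_trans (ler_normD _ _))//.
have -> : e = e / 2 + e / 2 by lra.
apply: ltr_leD; last exact: ltW.
rewrite normrZ /=; have cad : `|ratr c - a| <= d by rewrite ler_norml; lra.
apply: le_lt_trans (ler_wpM2r (normr_ge0 _) cad) _.
by rewrite /d mulrAC ltr_pdivrMr// ltr_pM2l//; lra.
Qed.

Variables (X : normedModType R).
Hypothesis reflX : reflexive_space X.
Variables (f : nat -> dual X) (M : R).
Hypothesis fM : forall n, `|f n| <= M.

Let fM_le n x : `|f n x| <= M * `|x|.
Proof. exact: le_trans (opnormP _ _) (ler_wpM2r (normr_ge0 _) (fM n)). Qed.

Let g (r : seq (rat * nat)) : dual X := lincomb f [seq (ratr p.1, p.2) | p <- r].

(** Hahn-Banach in the dual separates [h] from the span by an element of the bidual, and reflexivity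
    realises that element as a point. *)
Lemma closed_span_annihilator (h : dual X) : ~ closure (range g) h ->
  exists2 x : X, forall n, f n x = 0 & h x != 0.
Proof.
move=> /closure_normP/existsNP[e /not_implyP[e0 he]].
have he' s : e <= 1 * `|h - lincomb f s|.
  rewrite mul1r leNgt; apply/negP => hs; apply: he.
  have e'0 : 0 < e - `|h - lincomb f s| by rewrite subr_gt0.
  have [r rs] := lincomb_rat_approx f s e'0.
  exists (g r); first by exists r.
  have -> : g r - h = (g r - lincomb f s) - (h - lincomb f s).
    by rewrite opprB addrA subrK.
  by rewrite (le_lt_trans (ler_normB _ _))// -ltrBrDr.
have [Phi [PhiM Phih Phif]] :=
  separate_lincomb (sublinear_norm (ler01 : 0 <= 1 :> R)) (ltW e0) he'.
have [Phi' Phi'E] := dual_of_bounded PhiM.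
have [x xE] := reflX Phi'; exists x => [n|]; rewrite -xE Phi'E//.
by rewrite gt_eqF// (lt_le_trans e0).
Qed.

(** Separability of [X] for the seminorm [sup_n |f n y|], which replaces separability of the norm.
    The points [xs r] almost norm the rational combinations of the [f n]; a functional dominated by
    the seminorm that vanishes on all of them is shown to be zero. *)
Lemma countable_seminorm_dense : exists xs : seq (rat * nat) -> X,
  forall x (e : R), 0 < e ->
    exists s, forall n, `|f n (x - lincomb xs s)| <= e.
Proof.
have [xs xsP] : {xs : _ -> X & forall r, `|xs r| <= 1 /\ `|g r| <= 2 * g r (xs r)}.
  apply: (@choice _ _ (fun r x => `|x| <= 1 /\ `|g r| <= 2 * g r x)) => r.
  by have [x x1 gx] := dual_norming (g r); exists x.
exists xs => x e e0; apply: contrapT => /forallNP nx.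
pose q (y : X) := sup (range (fun n => `|f n y|)).
have q_sup y : has_sup (range (fun n => `|f n y|)).
  split; first by exists `|f 0%N y|, 0%N.
  by exists (M * `|y|) => _ [n _ <-].
have fq n y : `|f n y| <= q y by apply: ub_le_sup; [case: (q_sup y)|exists n].
have q_le y c : (forall n, `|f n y| <= c) -> q y <= c.
  by move=> fc; apply: ge_sup; [case: (q_sup y)|move=> _ [n _ <-]].
have sq : sublinear q.
  split=> [y z|t y t0]; apply: q_le => n.
    by rewrite linearD; exact: le_trans (ler_normD _ _) (lerD (fq _ _) (fq _ _)).
  by rewrite linearZ /= normrM ger0_norm// ler_wpM2l// fq.
have qx s : e <= q (x - lincomb xs s).
  have /existsNP[n /negP] := nx s; rewrite -ltNge => /ltW; move/le_trans; exact.
have [h [hq hx hxs]] := separate_lincomb sq (ltW e0) qx.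
have hM y : h y <= M * `|y| by apply: le_trans (hq _) (q_le _ _ _).
have [h' h'E] := dual_of_bounded hM.
(* If [g r] is within [d] of [h'], then [h' (xs r) = 0] gives [|g r| <= 2 * d], hence
   [|h'| <= 3 * d]. Otherwise some [x0] is killed by every [f n] but not by [h'], although [h' <= q]
   and [q] vanishes at [x0] and [- x0]. *)
have [hg|/closed_span_annihilator[x0 fx0]] := pselect (closure (range g) h').
  have h'0 d : 0 < d -> `|h'| <= 3 * d.
    move=> d0; have /closure_normP/(_ _ d0)[_ [r _ <-] gh] := hg.
    have [x1 gx] := xsP r.
    have : (g r - h') (xs r) <= d.
      rewrite (le_trans (ler_norm _))// (le_trans (opnormP _ _))//.
      by rewrite -[d]mulr1 ler_pM ?opnorm_ge0// ltW.
    rewrite dualBE h'E hxs subr0 => gd.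
    have : `|h'| <= `|g r| + `|g r - h'| by rewrite -{1}(subKr (g r) h') ler_normB.
    by lra.
  have hx0 : h' x = 0.
    apply/eqP; rewrite -normr_le0 (le_trans (opnormP _ _))//.
    suff -> : opnorm h' = 0 by rewrite mul0r.
    apply/eqP; rewrite eq_le opnorm_ge0 andbT; apply/ler_addgt0Pl => d d0.
    by rewrite addr0 (_ : d = 3 * (d / 3)) ?h'0 ?divr_gt0//; lra.
  by move: hx; rewrite -h'E hx0 leNgt e0.
have q0 y : (forall n, f n y = 0) -> q y <= 0.
  by move=> fy; apply: q_le => n; rewrite fy normr0.
have fNx0 n : f n (- x0) = 0 by rewrite linearN /= fx0 oppr0.
rewrite h'E => /eqP[]; have := le_trans (hq _) (q0 _ fx0).
by have := le_trans (hq _) (q0 _ fNx0); rewrite linearN /=; lra.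
Qed.

(** A pointwise limit along an ultrafilter provides [l]; the countable family [xs] then allows an
    honest sequence to be extracted. The map [phi] may fail to be increasing, but [k <= phi k] still
    sends it to infinity. *)
Theorem reflexive_bounded_weak_cvg : exists (phi : nat -> nat) (l : dual X),
  (forall k, (k <= phi k)%N) /\ weak_cvg (fun k => f (phi k)) l.
Proof.
have [U [UU oU]] := @ultraFilterLemma nat \oo _.
have [l lE] : {l : X -> R^o & forall x, f n x @[n --> U] --> l x}.
  apply: (@choice _ _ (fun x (y : R^o) => f n x @[n --> U] --> y)) => x.
  apply: (@ultrafilter_bounded_cvg _ _ _ _ (M * `|x|)) => //.
have UP : ProperFilter U := @ultra_proper _ _ UU.
have linl : linear l.
  move=> a x y.
  have cxy : f n (a *: x + y) @[n --> U] --> a *: l x + l y.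
    under eq_cvg do rewrite linearP.
    by apply: cvgD; [apply: cvgZl_tmp; exact: lE|exact: lE].
  exact: norm_cvg_unique (lE _) cxy.
pose hl := HB.pack_for {linear X -> R^o} l (GRing.isLinear.Build R X R^o *:%R l linl).
have hlM x : hl x <= M * `|x|.
  apply: (cvgr_to_le (lE x)); apply: nearW => n.
  exact: le_trans (ler_norm _) _.
have [l' l'E] := dual_of_bounded hlM.
have {lE} lE x : f n x @[n --> U] --> l' x by rewrite l'E.
have [xs xsP] := countable_seminorm_dense.
(* Stage [k] controls only the points [xs r] with code below [k]: finitely many conditions, each
   holding on a set of the ultrafilter. *)
have [phi phiP] : {phi : nat -> nat & forall k, (k <= phi k)%N /\
    forall r, (pickle r < k)%N -> `|l' (xs r) - f (phi k) (xs r)| < k.+1%:R^-1}.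
  apply: (@choice _ _ (fun k n => (k <= n)%N /\ forall r, (pickle r < k)%N ->
    `|l' (xs r) - f n (xs r)| < k.+1%:R^-1)) => k.
  have Uk i : U [set n | forall r, pickle r = i ->
      `|l' (xs r) - f n (xs r)| < k.+1%:R^-1].
    have [[r ri]|nr] := pselect (exists r, @pickle (seq (rat * nat)) r = i); last first.
      by apply: filterE => n r ri; case: nr; exists r.
    have := lE (xs r) => /cvgrPdist_lt/(_ k.+1%:R^-1).
    rewrite invr_gt0 ltr0n => /(_ isT); apply: filterS => n nl r' r'i.
    suff -> : r' = r by [].
    by apply: (pcan_inj pickleK); rewrite ri r'i.
  have Uk' j : U [set n | forall r, (pickle r < j)%N ->
      `|l' (xs r) - f n (xs r)| < k.+1%:R^-1].
    elim: j => [|j IH]; first exact: filterE.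
    apply: filterS2 (Uk j) IH => n nj nlt r; rewrite ltnS leq_eqVlt.
    by move=> /orP[/eqP|]; [exact: nj|exact: nlt].
  have Uge : U [set n | (k <= n)%N] by apply: oU; exists k.
  have [n [kn nP]] := filter_ex (filterI Uge (Uk' k)).
  by exists n.
exists phi, l'; split => [k|Phi]; first by case: (phiP k).
have [x xE] := reflX Phi; rewrite xE; under eq_cvg do rewrite xE.
have cs r : f (phi k) (xs r) @[k --> \oo] --> l' (xs r).
  apply/cvgrPdist_lt => e e0; near=> k.
  have rk : (pickle r < k)%N by near: k; exists (pickle r).+1.
  have [_ /(_ _ rk)/lt_trans] := phiP k; apply.
  by near: k; exact: near_infty_natSinv_lt (PosNum e0).
have cl s : f (phi k) (lincomb xs s) @[k --> \oo] --> l' (lincomb xs s).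
  elim: s => [|p s IH]; rewrite /lincomb ?big_nil ?big_cons.
    by rewrite linear0; under eq_cvg do rewrite linear0; exact: cvg_cst.
  rewrite linearP; under eq_cvg do rewrite linearP.
  by apply: cvgD => //; apply: cvgZl_tmp; exact: cs.
(* The bound on [x - lincomb xs s] is uniform in [n] and passes to the limit [l']; with convergence
   on the span this makes three errors of [e / 3]. *)
apply/cvgrPdist_le => e e0; have e30 : 0 < e / 3 by rewrite divr_gt0.
have [s sP] := xsP x _ e30; near=> k.
have lk : `|l' (lincomb xs s) - f (phi k) (lincomb xs s)| <= e / 3.
  by near: k; move: (cl s) => /cvgrPdist_le/(_ _ e30).
have lx : `|l' (x - lincomb xs s)| <= e / 3.
  by apply: (cvgr_to_le (cvg_norm (lE _))); apply: nearW => n; exact: sP.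
have := sP (phi k); move: lk lx; rewrite !linearB /= !ler_norml; lra.
Unshelve. all: by end_near. Qed.

End reflexive_sequential_compactness.

(** * Domains of maximal monotone operators *)

Section tame_points.
Context {R : realType} {X : normedModType R} (A : X -> set (dual X)).
Implicit Types (s : seq (R * (X * dual X))) (x y z : X).

Definition graph_weights s := {in s, forall p, 0 <= p.1 /\ A p.2.1 p.2.2}.

Definition mass s : R := \sum_(p <- s) p.1.

Definition barycenter s : X := lincomb (@fst X (dual X)) s.

Definition slope s : dual X := lincomb (@snd X (dual X)) s.

(** By [gapE] this is the left side of the Mazur-Orlicz criterion; this form shows that it is affine
    in [z]. *)
Definition gap s z : R := slope s z - \sum_(p <- s) p.1 * p.2.2 p.2.1.

(* Being tame is a convex condition on [y] that holds on the domain; conversely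
   a point around which it holds uniformly lies in the domain (tame_ball_dom). *)
Definition tame (N : R) y :=
  forall s, graph_weights s -> gap s y <= N * (mass s + `|barycenter s|).

Lemma slopeE s z : slope s z = \sum_(p <- s) p.1 * p.2.2 z.
Proof.
rewrite /slope /lincomb; elim: s => [|p s IH]; first by rewrite !big_nil.
by rewrite !big_cons dualDE dualZE IH.
Qed.

Lemma gapE s z : gap s z = \sum_(p <- s) p.1 * p.2.2 (z - p.2.1).
Proof.
rewrite /gap slopeE -sumrB; apply: eq_bigr => p _.
by rewrite linearB /= mulrBr.
Qed.

Lemma gap_convex s l y1 y2 :
  gap s ((1 - l) *: y1 + l *: y2) = (1 - l) * gap s y1 + l * gap s y2.
Proof. by rewrite /gap linearP linearZ /= /GRing.scale /=; ring. Qed.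

Lemma graph_weights_cat s1 s2 :
  graph_weights s1 -> graph_weights s2 -> graph_weights (s1 ++ s2).
Proof. by move=> h1 h2 p; rewrite mem_cat => /orP[/h1|/h2]. Qed.

Lemma graph_weightsZ t s : 0 <= t -> graph_weights s ->
  graph_weights [seq (t * p.1, p.2) | p <- s].
Proof.
by move=> t0 hs _ /mapP[p /hs[p0 Ap] ->]; split => //=; rewrite mulr_ge0.
Qed.

Lemma graph_weights1 u us : A u us -> graph_weights [:: (1, (u, us))].
Proof. by move=> Au p; rewrite inE => /eqP ->. Qed.

Lemma mass_ge0 s : graph_weights s -> 0 <= mass s.
Proof. by move=> hs; rewrite /mass big_seq sumr_ge0// => p /hs[]. Qed.

Lemma gap_cat s1 s2 z : gap (s1 ++ s2) z = gap s1 z + gap s2 z.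
Proof. by rewrite !gapE big_cat. Qed.

Lemma gapZ t s z : gap [seq (t * p.1, p.2) | p <- s] z = t * gap s z.
Proof.
rewrite !gapE big_map mulr_sumr; apply: eq_bigr => p _ /=.
by rewrite mulrA.
Qed.

Lemma mass_cat s1 s2 : mass (s1 ++ s2) = mass s1 + mass s2.
Proof. by rewrite /mass big_cat. Qed.

Lemma massZ t s : mass [seq (t * p.1, p.2) | p <- s] = t * mass s.
Proof. by rewrite /mass big_map mulr_sumr. Qed.

Lemma tame_le N N' y : N <= N' -> tame N y -> tame N' y.
Proof.
move=> NN' tN s hs; apply: le_trans (tN s hs) _.
by rewrite ler_wpM2r// addr_ge0// mass_ge0.
Qed.

Lemma tame_convex l N1 N2 y1 y2 : 0 <= l <= 1 -> tame N1 y1 -> tame N2 y2 ->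
  tame ((1 - l) * N1 + l * N2) ((1 - l) *: y1 + l *: y2).
Proof.
move=> /andP[l0 l1] t1 t2 s hs; rewrite gap_convex [leRHS]mulrDl -!mulrA lerD//.
  by rewrite ler_wpM2l ?subr_ge0// t1.
by rewrite ler_wpM2l// t2.
Qed.

Lemma tame1 N y u us : tame N y -> A u us -> us (y - u) <= N * (1 + `|u|).
Proof.
move=> tN /graph_weights1/tN.
by rewrite gapE /mass /barycenter lincomb1 !big_seq1 /= mul1r scale1r.
Qed.

Hypothesis monA : monotone_op A.

Lemma gap_dom s y ys : graph_weights s -> A y ys ->
  gap s y <= ys (mass s *: y - barycenter s).
Proof.
move=> hs Ay; rewrite gapE.
have -> : ys (mass s *: y - barycenter s) = \sum_(p <- s) p.1 * ys (y - p.2.1).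
  rewrite /mass /barycenter /lincomb scaler_suml -sumrB linear_sum /=.
  by apply: eq_bigr => p _; rewrite -scalerBr linearZ.
rewrite big_seq [leRHS]big_seq; apply: ler_sum => p /hs[p0 Ap].
by rewrite ler_wpM2l// -subr_ge0 -dualBE monA.
Qed.

Lemma tame_dom y ys : A y ys -> tame (`|ys| * (1 + `|y|)) y.
Proof.
move=> Ay s hs; apply: le_trans (gap_dom hs Ay) _.
apply: le_trans (ler_norm _) _; apply: le_trans (opnormP _ _) _.
rewrite -mulrA ler_wpM2l ?opnorm_ge0//; apply: le_trans (ler_normB _ _) _.
have m0 := mass_ge0 hs; rewrite normrZ ger0_norm//.
have := normr_ge0 y; have := normr_ge0 (barycenter s); nra.
Qed.

(* The weighted sum of [gap_dom] over the points [y] of [s] itself compares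
   a quantity with its opposite. *)
Lemma mass_gap_le s z : graph_weights s ->
  mass s * gap s z <= slope s (mass s *: z - barycenter s).
Proof.
move=> hs; set c := \sum_(p <- s) p.1 * p.2.2 p.2.1.
suff : slope s (barycenter s) <= mass s * c.
  by rewrite linearB linearZ /= /gap -/c mulrBr /GRing.scale /=; lra.
have -> : slope s (barycenter s) = mass s * c + \sum_(p <- s) p.1 * gap s p.2.1.
  rewrite /barycenter /lincomb linear_sum /= /mass mulr_suml -big_split /=.
  by apply: eq_bigr => p _; rewrite linearZ /= /gap -/c /GRing.scale /=; ring.
rewrite gerDl.
have : \sum_(p <- s) p.1 * gap s p.2.1 <=
    \sum_(p <- s) p.1 * p.2.2 (mass s *: p.2.1 - barycenter s).
  rewrite big_seq [leRHS]big_seq; apply: ler_sum => p ps.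
  have [p0 Ap] := hs _ ps.
  by rewrite ler_wpM2l// gap_dom.
have -> : \sum_(p <- s) p.1 * p.2.2 (mass s *: p.2.1 - barycenter s) =
    - \sum_(p <- s) p.1 * gap s p.2.1; last by lra.
transitivity (mass s * c - slope s (barycenter s)).
  rewrite slopeE /c mulr_sumr -sumrB; apply: eq_bigr => p _.
  by rewrite linearB linearZ /= /GRing.scale /=; ring.
rewrite /barycenter /lincomb linear_sum /= /mass mulr_suml -sumrB -sumrN.
by apply: eq_bigr => p _; rewrite linearZ /= /gap -/c /GRing.scale /=; ring.
Qed.

End tame_points.

Section maximal_monotone.
Context {R : realType} {X : normedModType R} (A : X -> set (dual X)).
Hypothesis maxA : maximal_monotone_op A.

(** Otherwise adjoining [(z, f)] to the graph would give a proper monotone extension. *)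
Lemma maximal_monotone_related z (f : dual X) :
  (forall u us, A u us -> 0 <= (us - f) (u - z)) -> A z f.
Proof.
move=> rel; apply: contrapT => nAz; have [monA] := maxA.
pose B x : set (dual X) := [set xs | A x xs \/ x = z /\ xs = f].
move=> /(_ B); apply.
  move=> x y xs ys [Ax|[-> ->]] [Ay|[-> ->]].
  - exact: monA.
  - exact: rel.
  - have := rel _ _ Ay; rewrite !dualBE !linearB /=; lra.
  - by rewrite dualBE subrr.
split; first by move=> [x xs] /= Ax; left.
by move=> /(_ (z, f)) /= zf; apply/nAz/zf; right.
Qed.

(** With [d = mass s *: z - barycenter s], Mazur-Orlicz needs [gap s z <= M * |d|]. Tameness at
    [z + t *: d] bounds [gap s z + t * slope s d], and [mass_gap_le] bounds [slope s d] below by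
    [mass s * gap s z]. On singletons the resulting functional is monotonically related to the
    graph. *)
Lemma tame_ball_dom (N : R) (rho : R) z : 0 < rho ->
  (forall w, `|w - z| <= rho -> tame A N w) -> op_dom A z.
Proof.
move=> rho0 tN; have monA := maxA.1.
pose N' := `|N|; have N'0 : 0 <= N' := normr_ge0 N.
have {}tN w : `|w - z| <= rho -> tame A N' w.
  by move=> /tN; apply: tame_le; exact: ler_norm.
pose M := N' * (1 + (1 + `|z|) / rho).
have M0 : 0 <= M by rewrite mulr_ge0// addr_ge0// divr_ge0 ?addr_ge0// ltW.
pose K : set (X * R) := [set (mass s *: z - barycenter s, gap s z) |
  s in graph_weights A].
have cK : convex_cone K.
  split.
  - exists [::] => //.
    by rewrite gapE /mass /barycenter /lincomb !big_nil scale0r subr0.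
  - move=> _ _ _ _ [s1 hs1 [<- <-]] [s2 hs2 [<- <-]].
    exists (s1 ++ s2); first exact: graph_weights_cat.
    by rewrite mass_cat gap_cat /barycenter lincomb_cat scalerDl opprD addrACA.
  - move=> t _ _ t0 [s hs [<- <-]].
    exists [seq (t * p.1, p.2) | p <- s]; first exact: graph_weightsZ.
    by rewrite massZ gapZ /barycenter lincombZ scalerBr scalerA.
have KM k b : K (k, b) -> b <= M * `|k|.
  move=> [s hs [<- <-]]; set d := _ - _; set m := mass s.
  have m0 : 0 <= m := mass_ge0 hs.
  have bary_le : `|barycenter s| <= m * `|z| + `|d|.
    have -> : barycenter s = m *: z - d by rewrite /d subKr.
    by rewrite (le_trans (ler_normB _ _))// normrZ ger0_norm.
  have gd : m * gap s z <= slope s d := mass_gap_le monA z hs.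
  (* There is no direction to push in when [d] vanishes: positive mass gives a nonpositive gap, and
     zero mass forces a zero barycenter, so tameness at [z] suffices. *)
  have [d0|d0] := eqVneq `|d| 0.
    rewrite d0 mulr0; move: gd; rewrite (normr0_eq0 d0) linear0.
    have [m00 _|mn0] := eqVneq m 0.
      have := tN z _ s hs; rewrite subrr normr0 (ltW rho0) => /(_ isT).
      move=> /le_trans; apply; rewrite -/m m00 add0r.
      suff -> : `|barycenter s| = 0 by rewrite mulr0.
      apply/eqP; rewrite eq_le normr_ge0 andbT.
      by rewrite (le_trans bary_le)// d0 m00 mul0r addr0.
    by rewrite pmulr_rle0// lt_neqAle eq_sym mn0.
  have {}d0 : 0 < `|d| by rewrite lt_neqAle eq_sym d0 normr_ge0.
  (* pushing [z] away from the barycenter by [rho] *)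
  pose t := rho / `|d|; have t0 : 0 < t by rewrite divr_gt0.
  have := tN (z + t *: d) _ s hs; rewrite addrAC subrr add0r normrZ gtr0_norm//.
  rewrite {1}/t divfK ?gt_eqF// lexx => /(_ isT).
  rewrite {1}/gap linearD linearZ /= addrAC -/(gap s z) -/m.
  have -> : t *: slope s d = t * slope s d by [].
  move=> gt; have {}gt : gap s z * (1 + t * m) <= N' * (m * (1 + `|z|) + `|d|).
    have : t * (m * gap s z) <= t * slope s d by rewrite ler_wpM2l// ltW.
    have : N' * (m + `|barycenter s|) <= N' * (m * (1 + `|z|) + `|d|).
      by rewrite ler_wpM2l//; lra.
    by lra.
  have tm : 0 < 1 + t * m by rewrite ltr_wpDr// mulr_ge0// ltW.
  rewrite -(ler_pM2r tm); apply: le_trans gt _.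
  have -> : M * `|d| * (1 + t * m) =
      N' * ((1 + (1 + `|z|) / rho) * `|d| + (rho * m + m * (1 + `|z|))).
    by rewrite /M /t; field; rewrite !gt_eqF.
  rewrite ler_wpM2l//.
  have : 0 <= (1 + `|z|) / rho * `|d|.
    by rewrite mulr_ge0// divr_ge0 ?addr_ge0// ltW.
  have : 0 <= rho * m by rewrite mulr_ge0// ltW.
  by lra.
have [f fK] := mazur_orlicz_dual M0 cK KM.
exists f; apply: maximal_monotone_related => u us Au.
have Ku : K (z - u, us (z - u)).
  exists [:: (1, (u, us))]; first exact: graph_weights1.
  by rewrite gapE /mass /barycenter lincomb1 !big_seq1 /= mul1r !scale1r.
by have := fK _ _ Ku; rewrite dualBE !linearB /=; lra.
Qed.

End maximal_monotone.

Lemma dual_norm_le (R : realType) (X : normedModType R) (f : dual X) (c : R) :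
  (forall x, `|x| <= 1 -> f x <= c) -> `|f| <= c.
Proof.
move=> fc; apply: opnorm_le => x x1; rewrite ler_norml fc// andbT.
by have := fc (- x); rewrite normrN linearN /= => /(_ x1); lra.
Qed.

(** * Local boundedness inside the domain *)

Definition bounded_ball (R : realType) (X : normedModType R)
    (A : X -> set (dual X)) (x0 : X) (r M : R) :=
  [/\ 0 < r, 0 <= M & forall b, `|b - x0| < r ->
    op_dom A b /\ forall bs, A b bs -> `|bs| <= M].

(** The sets [E n] cover a ball, so by Baire the closure of one of them contains a ball.
    Monotonicity against points of [E n] near [b + r *: e] then bounds [bs e] for every value [bs]
    at [b]. *)
Lemma monotone_bounded_ball (R : realType) (X : completeNormedModType R)
    (A : X -> set (dual X)) : monotone_op A -> interior (op_dom A) !=set0 ->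
  exists (x0 : X) (r M : R), bounded_ball A x0 r M.
Proof.
move=> monA [c /nbhs_ballP[rho /= rho0 domc]].
pose E (n : nat) := [set b | exists2 bs, A b bs & `|bs| <= n%:R] `&` ball c rho.
have [n nE] : exists n, ~ dense (~` closure (E n)).
  apply: contrapT => /forallNP dE.
  have /Baire : forall n, open (~` closure (E n)) /\ dense (~` closure (E n)).
    move=> n; split; first by rewrite openC; exact: closed_closure.
    by apply: contrapT; exact: dE.
  move=> /(_ (ball c rho)) /(_ _ (ball_open _ _)).
  case; first by exists c; exact: ballxx.
  move=> b [cb bE]; have [bs Ab] := domc _ cb.
  apply: (bE (Num.bound `|bs|) I); apply: subset_closure; split => //.
  by exists bs => //; rewrite ltW// archi_boundP.
have [W [[y [oW Wy]] WE]] := denseNE nE.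
have {}WE : W `<=` closure (E n).
  by move=> z Wz; apply: contrapT => nz; have : set0 z by rewrite -WE.
have [x0 [[Ex0 cx0] Wx0]] := WE _ Wy _ (open_nbhs_nbhs (conj oW Wy)).
have /nbhs_ballP[r2 /= r20 r2W] : nbhs x0 (W `&` ball c rho).
  by apply: filterI; apply: open_nbhs_nbhs; split => //; exact: ball_open.
(* Half the radius keeps [b + r *: e] within [r2] of [x0] for [e] in the unit ball. *)
pose r := r2 / 2; have r0 : 0 < r by rewrite divr_gt0.
exists x0, r, n%:R; split => // b bx0.
have r2E z : `|z - x0| < r2 -> closure (E n) z /\ ball c rho z.
  move=> zx; have /r2W[/WE ? ?] // : ball x0 r2 z.
  by rewrite -ball_normE /= distrC.
split=> [|bs Ab].
  by apply: domc; apply: (r2E _ _).2; rewrite (lt_trans bx0)// /r; lra.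
apply: dual_norm_le => e e1; rewrite -(ler_pM2l r0).
have /r2E[/closure_normP cE _] : `|b + r *: e - x0| < r2.
  rewrite addrAC (le_lt_trans (ler_normD _ _))//.
  rewrite normrZ gtr0_norm//; have : r * `|e| <= r by rewrite ler_piMr// ltW.
  by move: bx0; rewrite /r; lra.
(* Replacing [b + r *: e] by a point of [E n] at distance below [d / c'] costs at most
   [(n + |bs|) * (d / c') <= d]. *)
apply/ler_addgt0Pr => d d0; pose c' := n%:R + `|bs| + 1.
have c'0 : 0 < c' by rewrite ltr_wpDl// addr_ge0.
have dc0 : 0 < d / c' by rewrite divr_gt0.
have [u [[us Au usn] _] ud] := cE _ dc0.
have : bs (u - b) <= n%:R * (r + d / c').
  have := monA _ _ _ _ Au Ab; rewrite dualBE subr_ge0 => /le_trans; apply.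
  rewrite (le_trans (ler_norm _))// (le_trans (opnormP _ _))//.
  apply: ler_pM; rewrite ?opnorm_ge0//.
  have -> : u - b = r *: e + (u - (b + r *: e)).
    by rewrite opprD addrCA [r *: e + _]addrCA subrr addr0.
  rewrite (le_trans (ler_normD _ _))// lerD//; last exact: ltW.
  by rewrite normrZ gtr0_norm// ler_piMr// ltW.
have -> : u - b = r *: e + (u - (b + r *: e)).
  by rewrite opprD addrCA [r *: e + _]addrCA subrr addr0.
rewrite linearD linearZ /=.
have : - bs (u - (b + r *: e)) <= `|bs| * (d / c').
  rewrite -linearN (le_trans (ler_norm _))// (le_trans (opnormP _ _))//.
  by rewrite normrN ler_wpM2l ?opnorm_ge0// ltW.
have : (n%:R + `|bs|) * (d / c') <= d.
  by rewrite mulrCA ler_piMr ?(ltW d0)// ler_pdivrMr// mul1r /c'; lra.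
by rewrite /GRing.scale /=; lra.
Qed.

(** * Convexity of the closure of the domain *)

Section directional.
Context {R : realType} {X : normedModType R} (A : X -> set (dual X)).
Hypothesis maxA : maximal_monotone_op A.
Variables (x0 : X) (r M : R).
Hypothesis ballA : bounded_ball A x0 r M.

Let monA : monotone_op A := maxA.1.
Let r0 : 0 < r. Proof. by case: ballA. Qed.
Let M0 : 0 <= M. Proof. by case: ballA. Qed.
Let ballP b : `|b - x0| < r -> op_dom A b /\ forall bs, A b bs -> `|bs| <= M.
Proof. by case: ballA => _ _; exact. Qed.

Lemma tame_toward_ball N y l b : tame A N y -> 0 <= l <= 1 ->
  `|b - x0| < r ->
  tame A ((1 - l) * N + l * (M * (1 + (`|x0| + r)))) ((1 - l) *: y + l *: b).
Proof.
move=> tN l01 br; apply: tame_convex => //; have [[bs Ab] bM] := ballP br.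
apply: tame_le (tame_dom monA Ab).
apply: ler_pM; rewrite ?addr_ge0//; first exact: bM.
rewrite lerD2l -(subrK x0 b) addrC (le_trans (ler_normD _ _))//.
by rewrite lerD2l ltW.
Qed.

(** A convex combination [s] of domain points is tame. A small move towards [x0] surrounds it with a
    ball of uniformly tame points and so puts it in the domain. *)
Lemma closure_dom_convex y1 y2 (m : R) : 0 <= m <= 1 ->
  closure (op_dom A) y1 -> closure (op_dom A) y2 ->
  closure (op_dom A) ((1 - m) *: y1 + m *: y2).
Proof.
move=> m01 /closure_normP c1 /closure_normP c2; apply/closure_normP => e e0.
have e20 : 0 < e / 2 by rewrite divr_gt0.
have [s1 [s1s As1] s1e] := c1 _ e20; have [s2 [s2s As2] s2e] := c2 _ e20.
pose s := (1 - m) *: s1 + m *: s2.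
have tN := tame_convex m01 (tame_dom monA As1) (tame_dom monA As2).
rewrite -/s in tN; set N := (X in tame _ X) in tN.
have [/andP[m0 m1] d0] : 0 <= m <= 1 /\ 0 < `|x0 - s| + 1 by rewrite ltr_wpDl.
(* The denominator ensures both [l <= 1] and [l * |x0 - s| < e / 2]. *)
pose l := e / 2 / (`|x0 - s| + 1 + e / 2).
have dd0 : 0 < `|x0 - s| + 1 + e / 2 by rewrite addr_gt0.
have l0 : 0 < l by rewrite divr_gt0.
have l1 : l <= 1 by rewrite /l ler_pdivrMr// mul1r lerDr ltW.
exists ((1 - l) *: s + l *: x0).
  apply: (@tame_ball_dom _ _ _ maxA _ (l * r / 2)).
    by rewrite divr_gt0// mulr_gt0.
  move=> w wl.
  have -> : w = (1 - l) *: s + l *: (x0 + l^-1 *: (w - ((1 - l) *: s + l *: x0))).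
    rewrite [l *: (x0 + _)]scalerDr scalerA divff ?gt_eqF// scale1r.
    by rewrite addrA addrC subrK.
  apply: tame_toward_ball tN _ _; first by rewrite ltW.
  rewrite addrAC subrr add0r normrZ gtr0_norm ?invr_gt0// ltr_pdivrMl//.
  by apply: le_lt_trans wl _; rewrite ltr_pdivrMr//; have := mulr_gt0 l0 r0; lra.
have -> : (1 - l) *: s + l *: x0 - ((1 - m) *: y1 + m *: y2) =
    l *: (x0 - s) + ((1 - m) *: (s1 - y1) + m *: (s2 - y2)).
  have -> : (1 - m) *: (s1 - y1) + m *: (s2 - y2) = s - ((1 - m) *: y1 + m *: y2).
    by rewrite !scalerBr addrACA -opprD.
  rewrite addrA scalerBr scalerBl scale1r; congr (_ - _).
  by rewrite -addrA addrC [- _ + _]addrC.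
have le2 : `|l *: (x0 - s)| < e / 2.
  rewrite normrZ gtr0_norm// /l mulrAC ltr_pdivrMr//.
  by rewrite ltr_pM2l//; lra.
have : `|(1 - m) *: (s1 - y1) + m *: (s2 - y2)| <= e / 2.
  rewrite (le_trans (ler_normD _ _))// !normrZ !ger0_norm ?subr_ge0//.
  have : (1 - m) * `|s1 - y1| <= (1 - m) * (e / 2).
    by rewrite ler_wpM2l ?subr_ge0// ltW.
  have : m * `|s2 - y2| <= m * (e / 2) by rewrite ler_wpM2l// ltW.
  by lra.
by move: le2 => /ltr_leD /[apply]; rewrite -splitr; exact/le_lt_trans/ler_normD.
Qed.

End directional.

(** * Directional behaviour of selections *)

Lemma weak_cvg_pairing (R : realType) (X : normedModType R) (a : nat -> dual X)
    (l : dual X) (u : nat -> X) (y : X) (K : R) :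
  weak_cvg a l -> (\forall n \near \oo, `|a n| <= K) -> u n @[n --> \oo] --> y ->
  a n (u n) @[n --> \oo] --> l y.
Proof.
move=> al aK uy.
(* Weak convergence in the dual is tested on the bidual, so evaluation at [y] must be presented as
   an element of it. *)
have [ev evE] : exists ev : dual (dual X), forall f, ev f = f y.
  have lin_ev : linear (fun f : dual X => f y : R^o) by [].
  pose h := HB.pack_for {linear (dual X) -> R^o} (fun f : dual X => f y : R^o)
    (GRing.isLinear.Build R (dual X) R^o *:%R _ lin_ev).
  have hM f : h f <= `|y| * `|f|.
    by rewrite mulrC; exact: le_trans (ler_norm _) (opnormP _ _).
  have [ev evE] := dual_of_bounded hM; exists ev => f; exact: evE.
have {}al : a n y @[n --> \oo] --> l y.
  by have := al ev; rewrite evE; under eq_cvg do rewrite evE.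
have -> : l y = l y + 0 by rewrite addr0.
under eq_cvg => n.
  rewrite -[u n](subrK y) linearD /= addrC; over.
apply: cvgD => //; apply/norm_cvg0P.
have cK : (K * `|u n - y|) @[n --> \oo] --> (0 : R).
  rewrite -(mulr0 K); apply: cvgMr; apply/norm_cvg0P.
  by rewrite -(subrr y); apply: cvgB => //; exact: cvg_cst.
apply: (squeeze_cvgr _ (cvg_cst 0) cK); near=> n.
rewrite normr_ge0 /=; apply: le_trans (opnormP _ _) _.
by rewrite ler_wpM2r//; near: n.
Unshelve. all: by end_near. Qed.

(** * Boundedness and weak limits along tangent directions *)

Section directional_limits.
Context {R : realType} {X : normedModType R} (A : X -> set (dual X)).
Hypothesis maxA : maximal_monotone_op A.
Variables (x0 : X) (r M : R).
Hypothesis ballA : bounded_ball A x0 r M.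
Variables (x : X) (xs : dual X).
Hypothesis Ax : A x xs.

Let monA : monotone_op A := maxA.1.
Let r0 : 0 < r. Proof. by case: ballA. Qed.

(** Near [v - eta *: (x0 - x)] there is a [k = t^-1 *: (s - x)] with [s] in the domain. For [w] near
    [v], the point [x + t1 *: w] is then a convex combination of [s] and a point [b] of the ball
    around [x0]. *)
Lemma tangent_tame_ball v (eta : R) : 0 < eta ->
  tangent_cone x (closure (op_dom A)) (v - eta *: (x0 - x)) ->
  exists t0 rho N : R, [/\ 0 < t0, 0 < rho &
    forall w, `|w - v| <= rho -> tame A N (x + t0 *: w)].
Proof.
move=> eta0 /closure_normP Tv; set v' := v - _ in Tv.
have er0 : 0 < eta * r / 4 by rewrite divr_gt0// mulr_gt0.
have [_ [t /= t0 [c /closure_normP cc <-]] kv] := Tv _ er0.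
have ter0 : 0 < t * (eta * r / 4) by rewrite mulr_gt0.
have [s [ss As] sc] := cc _ ter0.
pose k := t^-1 *: (s - x).
have kv' : `|k - v'| < eta * r / 2.
  have -> : k - v' = t^-1 *: (s - c) + (t^-1 *: (c - x) - v').
    by rewrite addrA -scalerDr /k subrKA.
  have tsc : `|t^-1 *: (s - c)| < eta * r / 4.
    by rewrite normrZ gtr0_norm ?invr_gt0// ltr_pdivrMl.
  have -> : eta * r / 2 = eta * r / 4 + eta * r / 4 by lra.
  by rewrite (le_lt_trans (ler_normD _ _))// ltrD.
have D0 : 0 < 1 + eta * t by rewrite ltr_wpDr// mulr_ge0// ltW.
(* This solves [(1 - l) * t = t1] with [l = eta * t1], which makes the combination start from
   [x]. *)
pose t1 := t / (1 + eta * t); have t10 : 0 < t1 by rewrite divr_gt0.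
pose l := eta * t1.
have l01 : 0 <= l <= 1.
  apply/andP; split; first by rewrite mulr_ge0// ltW.
  by rewrite /l /t1 mulrA ler_pdivrMr// mul1r; lra.
have lt1 : (1 - l) * t = t1 by rewrite /l /t1; field; rewrite gt_eqF.
exists t1, (eta * r / 4),
  ((1 - l) * (`|ss| * (1 + `|s|)) + l * (M * (1 + (`|x0| + r)))).
split => // w wv.
pose b := eta^-1 *: (w - k) + x.
have -> : x + t1 *: w = (1 - l) *: s + l *: b.
  have -> : l *: b = t1 *: w - (1 - l) *: s + x.
    have tk : t1 *: k = (1 - l) *: s - (1 - l) *: x.
      by rewrite -lt1 /k scalerA mulfK ?gt_eqF// scalerBr.
    rewrite /b scalerDr scalerA /l mulrAC mulfV ?gt_eqF// mul1r -/l scalerBr tk.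
    rewrite [(1 - l) *: x]scalerBl scale1r opprB -addrA [_ - _ + l *: x]addrAC.
    by rewrite subrK [x - _]addrC addrA.
  by rewrite addrA subrKC addrC.
apply: (tame_toward_ball maxA ballA (tame_dom monA As)) => //.
have -> : b - x0 = eta^-1 *: ((w - v) - (k - v')).
  have -> : (w - v) - (k - v') = (w - k) - eta *: (x0 - x).
    by rewrite opprB addrA subrKA addrAC.
  by rewrite scalerBr scalerA mulVf ?gt_eqF// scale1r opprB addrA.
rewrite normrZ gtr0_norm ?invr_gt0// ltr_pdivrMl//.
rewrite (le_lt_trans (ler_normB _ _))//.
by have := mulr_gt0 eta0 r0; lra.
Qed.

(** Tameness at [x + t0 *: w'], with [w' = w + (rho / 2) *: e], bounds [a] from above on
    [(t0 - t) *: w + (t0 * (rho / 2)) *: e]. Monotonicity against [xs] bounds [a w] from below,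
    which leaves an upper bound for [a e]. *)
Lemma dir_bounded v (t0 rho N : R) : 0 < t0 -> 0 < rho ->
  (forall w, `|w - v| <= rho -> tame A N (x + t0 *: w)) ->
  exists K : R, forall t w a, 0 < t <= t0 -> `|w - v| <= rho / 2 ->
    A (x + t *: w) a -> `|a| <= K.
Proof.
move=> t00 rho0 tN.
pose B := `|v| + rho / 2.
pose N' := `|N| * (1 + (`|x| + t0 * B)) + t0 * (`|xs| * B).
exists (N' / (t0 * (rho / 2))) => t w a /andP[t0' tt0] wv Aa.
have wB : `|w| <= B.
  by rewrite -(subrK v w) addrC (le_trans (ler_normD _ _))// lerD2l.
have B0 : 0 <= B by rewrite addr_ge0// divr_ge0// ltW.
have tr0 : 0 < t0 * (rho / 2) by rewrite !mulr_gt0 ?invr_gt0.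
apply: dual_norm_le => e e1; rewrite ler_pdivlMr//.
pose w' := w + (rho / 2) *: e.
have w'v : `|w' - v| <= rho.
  rewrite /w' addrAC (le_trans (ler_normD _ _))// normrZ gtr0_norm ?divr_gt0//.
  have : rho / 2 * `|e| <= rho / 2 by rewrite ler_piMr// divr_ge0// ltW.
  by move: wv; lra.
have aw : xs w <= a w.
  have := monA Aa Ax; rewrite addrAC subrr add0r.
  have -> : (a - xs) (t *: w) = t * (a w - xs w) by rewrite linearZ.
  by rewrite pmulr_rge0// subr_ge0.
have := tame1 (tN _ w'v) Aa.
have -> : x + t0 *: w' - (x + t *: w) = (t0 - t) *: w + (t0 * (rho / 2)) *: e.
  rewrite opprD addrACA subrr add0r /w' scalerDr scalerA scalerBl.
  by rewrite addrAC.
rewrite linearD !linearZ /= /GRing.scale /=.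
have xsw : - (`|xs| * B) <= xs w.
  rewrite lerNl -linearN (le_trans (ler_norm _))// (le_trans (opnormP _ _))//.
  by rewrite normrN ler_wpM2l ?opnorm_ge0.
have h1 : - (t0 * (`|xs| * B)) <= (t0 - t) * a w.
  have : (t0 - t) * - (`|xs| * B) <= (t0 - t) * a w.
    by rewrite ler_wpM2l ?subr_ge0// (le_trans xsw).
  apply: le_trans; have : 0 <= t * (`|xs| * B) by rewrite !mulr_ge0// ltW.
  lra.
have h2 : N * (1 + `|x + t *: w|) <= `|N| * (1 + (`|x| + t0 * B)).
  apply: (@le_trans _ _ (`|N| * (1 + `|x + t *: w|))).
    by rewrite ler_wpM2r ?ler_norm// addr_ge0.
  rewrite ler_wpM2l// lerD2l (le_trans (ler_normD _ _))// lerD2l.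
  by rewrite normrZ gtr0_norm// ler_pM// ltW.
rewrite /N' [a e * _]mulrC; lra.
Qed.

Variables (D : set X) (At : X -> dual X).
Hypothesis DA : D `<=` op_dom A.
Hypothesis AD : op_dom A `<=` closure D.
Hypothesis selA : is_selection A At.

(** Boundedness lets pairings pass to the limit: monotonicity against the whole graph yields
    [A x xi], and against [ys] at [x], after division by [t n], it yields [ys v <= xi v]. *)
Lemma w_Limsup_support v (eta : R) (w : nat -> X) (t : nat -> R) (xi : dual X) :
  0 < eta ->
  tangent_cone x (closure (op_dom A)) (v - eta *: (x0 - x)) ->
  w n @[n --> \oo] --> v -> (forall n, 0 < t n) -> t n @[n --> \oo] --> 0 ->
  (forall n, D (x + t n *: w n)) ->
  weak_cvg (fun n => At (x + t n *: w n)) xi ->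
  [/\ A x xi, At (x + t n *: w n) (w n) @[n --> \oo] --> xi v &
      forall ys, A x ys -> ys v <= xi v].
Proof.
move=> eta0 Tv wv t0 tc Dn aw.
have [t1 [rho [N [t10 rho0 tN]]]] := tangent_tame_ball eta0 Tv.
have [K aK] := dir_bounded t10 rho0 tN.
have An n : A (x + t n *: w n) (At (x + t n *: w n)) by exact/selA/DA.
have anK : \forall n \near \oo, `|At (x + t n *: w n)| <= K.
  near=> n; apply: aK (An n); rewrite ?t0 /=.
    by near: n; apply: (cvgr_le _ tc).
  rewrite distrC; near: n; move/cvgrPdist_le: wv; apply.
  by rewrite divr_gt0.
have yx : (x + t n *: w n) @[n --> \oo] --> x.
  rewrite -[X in _ --> X]addr0 -(scale0r v).
  by apply: cvgD; [exact: cvg_cst|exact: cvgZ].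
have aww := weak_cvg_pairing aw anK wv.
split => // [|ys Ays].
  apply: (maximal_monotone_related maxA) => u us Au.
  have uy : (u - (x + t n *: w n)) @[n --> \oo] --> u - x.
    by apply: cvgB => //; exact: cvg_cst.
  rewrite dualBE.
  have cus : us (u - (x + t n *: w n)) @[n --> \oo] --> us (u - x).
    exact: (continuous_cvg _ (@dual_continuous _ _ us _) uy).
  apply: (cvgr_to_ge (cvgB cus (weak_cvg_pairing aw anK uy))).
  by apply: nearW => n; exact: (monA Au (An n)).
rewrite -subr_ge0.
have cys : ys (w n) @[n --> \oo] --> ys v.
  exact: (continuous_cvg _ (@dual_continuous _ _ ys _) wv).
apply: (cvgr_to_ge (cvgB aww cys)); apply: nearW => n /=.
have := monA (An n) Ays; rewrite addrAC subrr add0r.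
have -> : (At (x + t n *: w n) - ys) (t n *: w n) =
  t n * (At (x + t n *: w n) (w n) - ys (w n)) by rewrite linearZ.
by rewrite pmulr_rge0.
Unshelve. all: by end_near. Qed.

Hypothesis reflX : reflexive_space X.

(** The point [x + t1 *: v] is in the domain, so by convexity the segment from [x] to it lies in the
    closure, where [D] is dense. This yields admissible directions, and the values along them are
    bounded. *)
Lemma w_Limsup_nonempty v (eta : R) : 0 < eta ->
  tangent_cone x (closure (op_dom A)) (v - eta *: (x0 - x)) ->
  w_Limsup At D x v !=set0.
Proof.
move=> eta0 Tv.
have [t1 [rho [N [t10 rho0 tN]]]] := tangent_tame_ball eta0 Tv.
have [K aK] := dir_bounded t10 rho0 tN.
have dom1 : op_dom A (x + t1 *: v).
  apply: (tame_ball_dom maxA (rho := t1 * rho)); first by rewrite mulr_gt0.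
  move=> y yr; have -> : y = x + t1 *: (v + t1^-1 *: (y - (x + t1 *: v))).
    by rewrite scalerDr scalerA divff ?gt_eqF// scale1r addrA subrKC.
  apply: tN; rewrite addrAC subrr add0r normrZ gtr0_norm ?invr_gt0//.
  by rewrite ler_pdivrMl.
pose t n : R := t1 * n.+1%:R^-1.
have t0 n : 0 < t n by rewrite mulr_gt0// invr_gt0.
have tt1 n : t n <= t1 by rewrite ler_piMr ?(ltW t10)// invf_le1// ler1n.
have [w wP] : {w : nat -> X & forall n, [/\ D (x + t n *: w n),
    `|w n - v| <= rho / 2 & `|w n - v| <= n.+1%:R^-1]}.
  apply: (@choice _ _ (fun n w => [/\ D (x + t n *: w), `|w - v| <= rho / 2 &
    `|w - v| <= n.+1%:R^-1])) => n.
  have : closure (op_dom A) (x + t n *: v).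
    have -> : x + t n *: v =
        (1 - n.+1%:R^-1) *: x + n.+1%:R^-1 *: (x + t1 *: v).
      by rewrite scalerDr addrA -scalerDl subrK scale1r scalerA mulrC.
    apply: (closure_dom_convex maxA ballA); last 2 first.
    - by apply: subset_closure; exists xs.
    - exact: subset_closure.
    by rewrite invr_ge0 ler0n invf_le1// ler1n.
  have cl : closure (op_dom A) `<=` closure D.
    by rewrite [X in _ `<=` X](closure_id _).1; [exact: closureS|exact: closed_closure].
  move=> /cl/closure_normP.
  (* The factor [t n] offsets the division defining the direction; [rho / 2] meets the range of
     [dir_bounded] and the other bound forces [w n] to tend to [v]. *)
  have d0 : 0 < t n * Num.min (rho / 2) n.+1%:R^-1.
    by rewrite mulr_gt0// lt_min divr_gt0//= invr_gt0.
  move=> /(_ _ d0)[y Dy yd]; exists ((t n)^-1 *: (y - x)).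
  have yt : x + t n *: ((t n)^-1 *: (y - x)) = y.
    by rewrite scalerA divff ?gt_eqF// scale1r subrKC.
  have : `|(t n)^-1 *: (y - x) - v| <= Num.min (rho / 2) n.+1%:R^-1.
    have -> : (t n)^-1 *: (y - x) - v = (t n)^-1 *: (y - (x + t n *: v)).
      by rewrite opprD addrA [RHS]scalerBr scalerA mulVf ?gt_eqF// scale1r.
    by rewrite normrZ gtr0_norm ?invr_gt0// ler_pdivrMl// ltW.
  by rewrite le_min => /andP[? ?]; rewrite yt.
have atK n : `|At (x + t n *: w n)| <= K.
  have [Dn wr _] := wP n; apply: aK wr (selA (DA Dn)).
  by rewrite t0 tt1.
have [phi [l [phik phil]]] := reflexive_bounded_weak_cvg reflX atK.
have phi_oo : phi k @[k --> \oo] --> \oo.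
  move=> B [n _ nB]; exists n => // k /= nk; apply: nB => /=.
  exact: leq_trans nk (phik k).
have inv0 : (n.+1%:R^-1 : R) @[n --> \oo] --> 0.
  apply/cvgrPdist_lt => e e0; near=> n.
  rewrite sub0r normrN gtr0_norm ?invr_gt0//.
  by near: n; exact: near_infty_natSinv_lt (PosNum e0).
have wv : w n @[n --> \oo] --> v.
  apply/cvgrPdist_lt => e e0; near=> n; rewrite distrC.
  have [_ _ /le_lt_trans] := wP n; apply.
  by near: n; exact: near_infty_natSinv_lt (PosNum e0).
exists l, (w \o phi), (t \o phi); split => //=.
- exact: cvg_comp phi_oo wv.
- split => //; apply: (cvg_comp _ _ phi_oo).
  by rewrite -(mulr0 t1); apply: cvgMr.
- by move=> n; have [] := wP (phi n).
Unshelve. all: by end_near. Qed.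

End directional_limits.

(** The cone [C] spanned by [S - x] stays at distance at least [e] from [v]; Mazur-Orlicz with the
    norm and the pairs [(t *: v - k, e * t)], [k] in [C], gives [f v >= e] and [f <= 0] on [C]. *)
Lemma tangent_cone_separation (R : realType) (X : normedModType R) (S : set X)
    (x v : X) :
  (forall y1 y2 (m : R), 0 <= m <= 1 -> S y1 -> S y2 ->
    S ((1 - m) *: y1 + m *: y2)) ->
  S x -> ~ tangent_cone x S v ->
  exists f : dual X, 0 < f v /\ forall c, S c -> f (c - x) <= 0.
Proof.
move=> convS Sx /closure_normP/existsNP[e /not_implyP[e0 ve]].
pose C : set X := [set k | exists (a : R) c, [/\ 0 <= a, S c & k = a *: (c - x)]].
have CD k1 k2 : C k1 -> C k2 -> C (k1 + k2).
  move=> [a1 [c1 [a10 Sc1 ->]]] [a2 [c2 [a20 Sc2 ->]]].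
  have [a0|an0] := eqVneq (a1 + a2) 0.
    exists 0, x; split => //.
    have [-> ->] : a1 = 0 /\ a2 = 0 by split; lra.
    by rewrite !scale0r addr0.
  have a0 : 0 < a1 + a2 by rewrite lt_neqAle eq_sym an0 addr_ge0.
  exists (a1 + a2), ((1 - a2 / (a1 + a2)) *: c1 + (a2 / (a1 + a2)) *: c2).
  split; [exact: ltW| |].
    apply: convS => //; rewrite divr_ge0 ?(ltW a0)//= ler_pdivrMr// mul1r.
    by rewrite lerDr.
  rewrite [RHS]scalerBr [X in _ = X - _]scalerDr !scalerA.
  have -> : (a1 + a2) * (1 - a2 / (a1 + a2)) = a1 by field.
  have -> : (a1 + a2) * (a2 / (a1 + a2)) = a2 by field.
  by rewrite scalerDl opprD [in RHS]addrACA !scalerBr.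
have CZ a k : 0 <= a -> C k -> C (a *: k).
  move=> a0 [b [c [b0 Sc ->]]]; exists (a * b), c.
  by rewrite scalerA mulr_ge0.
have ev k : C k -> e <= `|v - k|.
  move=> [a [c [a0 Sc ->]]]; rewrite leNgt; apply/negP => vk; apply: ve.
  move: a0; rewrite le_eqVlt => /orP[/eqP az|a0].
    exists 0; last by move: vk; rewrite -az scale0r subr0 sub0r normrN.
    by exists 1; [rewrite /= ltr01|exists x => //; rewrite subrr scaler0].
  exists (a *: (c - x)); last by rewrite distrC.
  by exists a^-1; [rewrite /= invr_gt0|exists c => //; rewrite invrK].
pose K : set (X * R) := [set q | exists (t : R) k, [/\ 0 <= t, C k,
  q.1 = t *: v - k & q.2 = e * t]].
have C0 : C 0 by exists 0, x; rewrite scale0r.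
have cK : convex_cone K.
  split.
  - by exists 0, 0; rewrite scale0r subr0 mulr0.
  - move=> _ _ _ _ [t1 [k1 [t10 Ck1 /= -> ->]]] [t2 [k2 [t20 Ck2 /= -> ->]]].
    exists (t1 + t2), (k1 + k2); split; rewrite /= ?addr_ge0 ?mulrDr//.
      exact: CD.
    by rewrite scalerDl opprD addrACA.
  - move=> a _ _ a0 [t [k [t0 Ck /= -> ->]]].
    exists (a * t), (a *: k); split; rewrite /= ?mulr_ge0//.
    + exact: CZ.
    + by rewrite scalerBr scalerA.
    + by rewrite mulrCA.
have K1 k b : K (k, b) -> b <= 1 * `|k|.
  move=> [t [h [t0 Ch /= -> ->]]]; rewrite mul1r.
  move: t0; rewrite le_eqVlt => /orP[/eqP<-|t0]; first by rewrite mulr0.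
  have := ev _ (CZ t^-1 _ _ Ch); rewrite invr_ge0 (ltW t0) => /(_ isT).
  rewrite -(ler_pM2l t0) mulrC => /le_trans; apply.
  rewrite -[X in X * _](gtr0_norm t0) -normrZ scalerBr scalerA.
  by rewrite divff ?gt_eqF// scale1r.
have [f fK] := mazur_orlicz_dual ler01 cK K1; exists f; split.
  apply: lt_le_trans e0 _; apply: fK; exists 1, 0.
  by rewrite scale1r subr0 mulr1 ler01.
move=> c Sc; have : 0 <= f (- (c - x)).
  apply: fK; exists 0, (c - x); split; rewrite ?mulr0 ?scale0r ?sub0r//.
  by exists 1, c; rewrite scale1r ler01.
by rewrite linearN /= oppr_ge0.
Qed.

Lemma normal_unbounded_support (R : realType) (X : normedModType R)
    (A : X -> set (dual X)) (x v : X) (f : dual X) :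
  maximal_monotone_op A -> op_dom A x -> 0 < f v ->
  (forall y, op_dom A y -> f (y - x) <= 0) -> support_fun A x v = +oo%E.
Proof.
move=> maxA [xs Ax] fv fN.
have Axf (a : R) : 0 <= a -> A x (xs + a *: f).
  move=> a0; apply: (maximal_monotone_related maxA) => u us Au.
  have fu : f (u - x) <= 0 by apply: fN; exists us.
  have := maxA.1 _ _ _ _ Au Ax; have : 0 <= a * - f (u - x).
    by rewrite mulr_ge0// oppr_ge0.
  by rewrite !dualBE dualDE dualZE; lra.
(* This multiple gives [xs v + a * f v = xs v + |b| + |xs v|], which is at least [b]. *)
apply: eq_infty => b; pose a := (`|b| + `|xs v|) / f v.
have a0 : 0 <= a by rewrite divr_ge0 ?addr_ge0// ltW.
apply: le_ereal_sup_tmp; exists ((xs + a *: f) v)%:E.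
  by exists (xs + a *: f) => //; exact: Axf.
rewrite lee_fin dualDE dualZE /a divfK ?gt_eqF//.
by have := ler_norm b; have := ler_norm (- xs v); rewrite normrN; lra.
Qed.

(** * The support function according to the position of the direction *)

Theorem theorem4p1 (R : realType) (X : completeNormedModType R)
    (A : X -> set (dual X)) (D : set X) (At : X -> dual X) :
  reflexive_space X ->
  maximal_monotone_op A ->
  interior (op_dom A) !=set0 ->
  D `<=` op_dom A -> op_dom A `<=` closure D ->
  is_selection A At ->
  forall x v : X, op_dom A x -> v != 0 ->
    let T := tangent_cone x (closure (op_dom A)) in
    [/\ interior T v ->
          w_Limsup At D x v !=set0 /\
          forall xi, w_Limsup At D x v xi -> support_fun A x v = (xi v)%:E,
        boundary T v -> support_fun A x v = dir_liminf At D x v &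
        ~ interior T v -> ~ boundary T v -> support_fun A x v = +oo%E].
Proof.
move=> reflX maxA intA DA AD selA x v domx _ T.
have [x0 [r [M ballA]]] := monotone_bounded_ball maxA.1 intA.
have [xs Ax] := domx; split.
- move=> /nbhs_ballP[e /= e0 eT].
  (* Small enough for [v - eta *: (x0 - x)] to stay in the ball around [v] contained in [T]. *)
  pose eta := e / 2 / (`|x0 - x| + 1).
  have d0 : 0 < `|x0 - x| + 1 by rewrite ltr_wpDl.
  have eta0 : 0 < eta by rewrite !divr_gt0.
  have Tv : T (v - eta *: (x0 - x)).
    apply: eT; rewrite -ball_normE /= subKr normrZ gtr0_norm//.
    rewrite /eta mulrAC ltr_pdivrMr//.
    by have := mulr_ge0 (ltW e0) (normr_ge0 (x0 - x)); lra.
  split; first exact: (w_Limsup_nonempty maxA ballA Ax DA AD selA reflX eta0 Tv).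
  move=> xi [w [t [wv [t0 tc] Dn aw]]].
  have [Axi _ xiP] :=
    w_Limsup_support maxA ballA Ax DA selA eta0 Tv wv t0 tc Dn aw.
  apply/eqP; rewrite eq_le; apply/andP; split.
    by apply: ge_ereal_sup => _ [ys Ays <-]; rewrite lee_fin xiP.
  by apply: le_ereal_sup_tmp; exists (xi v)%:E => //; exists xi.
- move=> [+ _]; rewrite -((closure_id T).1 (@closed_closure _ _)) => Tv.
  apply/eqP; rewrite eq_le; apply/andP; split.
    apply: ge_ereal_sup => _ [ys Ays <-].
    apply/lee_addgt0Pr => d d0.
    (* For [w] within [e] of [v], [ys w] differs from [ys v] by at most [d]. *)
    pose e := d / (`|ys| + 1).
    have n0 : 0 < `|ys| + 1 by rewrite ltr_wpDl.
    have e0 : 0 < e by rewrite divr_gt0.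
    rewrite -leeBlDr//; apply: le_ereal_sup_tmp.
    exists (ereal_inf [set (At (x + p.1 *: p.2) p.2)%:E | p in
        [set p : R * X | [/\ `|p.2 - v| < e, 0 < p.1 < e &
                             D (x + p.1 *: p.2)]]]); first by exists e.
    apply: le_ereal_inf_tmp => _ [[t w] /= [wv /andP[t0 _] Dw] <-].
    rewrite -EFinB lee_fin.
    have ysw : ys w <= At (x + t *: w) w.
      have := maxA.1 _ _ _ _ (selA _ (DA _ Dw)) Ays; rewrite addrAC subrr add0r.
      have -> : (At (x + t *: w) - ys) (t *: w) = t * (At (x + t *: w) w - ys w).
        by rewrite linearZ.
      by rewrite pmulr_rge0// subr_ge0.
    apply: le_trans ysw; rewrite lerBlDr -lerBlDl -linearB.
    rewrite (le_trans (ler_norm _))// (le_trans (opnormP _ _))// distrC.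
    apply: (@le_trans _ _ (`|ys| * e)); first by rewrite ler_wpM2l ?opnorm_ge0// ltW.
    by rewrite /e mulrCA ler_piMr ?(ltW d0)// ler_pdivrMr//; lra.
  have [->|Sfin] := eqVneq (support_fun A x v) +oo%E; first exact: leey.
  apply: ge_ereal_sup => _ [e /= e0 <-]; apply/lee_addgt0Pr => d d0.
  have [r0 M0 ballP] := ballA.
  have [[x0s Ax0] _] : op_dom A x0 /\ forall bs, A x0 bs -> `|bs| <= M.
    by apply: ballP; rewrite subrr normr0.
  pose c := `|x0s (x0 - x)| + 1; have c0 : 0 < c by rewrite ltr_wpDl.
  pose n := `|x0 - x| + 1; have n0 : 0 < n by rewrite ltr_wpDl.
  (* The first bound limits the excess [eta * xi (x0 - x)] to [d / 2]; the second keeps the pushed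
     direction within [e / 2] of [v]. *)
  pose eta := Num.min (d / c / 2) (e / n / 2).
  have eta0 : 0 < eta by rewrite lt_min !divr_gt0.
  have etac : eta * c <= d / 2.
    have : eta <= d / c / 2 by rewrite ge_min lexx.
    rewrite -(ler_pM2r c0) => /le_trans; apply.
    by rewrite mulrAC divfK ?gt_eqF.
  have etan : eta * n <= e / 2.
    have : eta <= e / n / 2 by rewrite ge_min lexx orbT.
    rewrite -(ler_pM2r n0) => /le_trans; apply.
    by rewrite mulrAC divfK ?gt_eqF.
  have Tv' : T (v + eta *: (x0 - x) - eta *: (x0 - x)) by rewrite addrK.
  have [xi [w [t [wv [t0 tc] Dn aw]]]] :=
    w_Limsup_nonempty maxA ballA Ax DA AD selA reflX eta0 Tv'.
  have [Axi cxi _] :=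
    w_Limsup_support maxA ballA Ax DA selA eta0 Tv' wv t0 tc Dn aw.
  have xiS : ((xi v)%:E <= support_fun A x v)%E.
    by apply: le_ereal_sup_tmp; exists (xi v)%:E => //; exists xi.
  (* Monotonicity between [x0] and [x] gives [xi (x0 - x) <= x0s (x0 - x)], a bound that does not
     depend on [eta]. *)
  have xid : xi (v + eta *: (x0 - x)) <= xi v + d / 2.
    rewrite linearD linearZ /= lerD2l (le_trans _ etac)// /GRing.scale /=.
    rewrite ler_pM2l//; have := maxA.1 _ _ _ _ Ax0 Axi.
    by rewrite dualBE /c; have := ler_norm (x0s (x0 - x)); lra.
  near \oo => k.
  apply: (@le_trans _ _ (xi v + d)%:E); last by rewrite EFinD leeD2r.
  apply: ge_ereal_inf; exists (At (x + t k *: w k) (w k))%:E.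
    exists (t k, w k) => //=; split => //.
      have -> : w k - v = (w k - (v + eta *: (x0 - x))) + eta *: (x0 - x).
        by rewrite opprD addrA subrK.
      rewrite (le_lt_trans (ler_normD _ _))// normrZ gtr0_norm//.
      have : `|w k - (v + eta *: (x0 - x))| < e / 2.
        rewrite distrC; near: k; move/cvgrPdist_lt: wv; apply.
        by rewrite divr_gt0.
      have : eta * `|x0 - x| <= eta * n by rewrite ler_pM2l// /n; lra.
      by lra.
    rewrite t0 /=; near: k; exact: (cvgr_lt _ tc).
  rewrite lee_fin; near: k; apply: (cvgr_le _ cxi).
  by lra.
- move=> nint nbd; have nT : ~ T v.
    by move=> Tv; apply: nbd; split => //; exact: subset_closure.
  have [|f [fv fN]] := tangent_cone_separation
    (closure_dom_convex maxA ballA) _ nT; first exact: subset_closure.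
  apply: (normal_unbounded_support maxA domx fv) => y domy.
  exact/fN/subset_closure.
Unshelve. all: by end_near. Qed.
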